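(* Let $\mathbb{U}=(U,\mathcal{B})$ be a unital of order $q>2$, and let $\mathcal{C}\subseteq\mathcal{B}$ be a set of mutually intersecting blocks (i.e., a clique in the confluence graph of $\mathbb{U}$). Then $|\mathcal{C}|\le q^2$, and $|\mathcal{C}|=q^2$ holds if and only if there is a point $x\in U$ such that $\mathcal{C}=\mathcal{B}_x$ is the set of all blocks through $x$.
   Context: A unital of order $q>1$ (with $q$ an integer) is a $2$-$(q^3+1,q+1,1)$ design $\mathbb{U}=(U,\mathcal{B})$: a set $U$ of $q^3+1$ points and a set $\mathcal{B}$ of blocks, each block being a $(q+1)$-subset of $U$, such that any two distinct points lie in exactly one common block. For $x\in U$, $\mathcal{B}_x$ denotes the set of blocks containing $x$ (the pencil of $x$). The confluence graph of $\mathbb{U}$ has vertex set $\mathcal{B}$, two distinct blocks being adjacent if they share a point. *)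

(* Defs.v *)
From mathcomp Require Import all_boot.

Set Implicit Arguments.
Unset Strict Implicit.
Unset Printing Implicit Defensive.

(* The points are all the elements of the finite type U. As B is a set of
   subsets of U, there are no repeated blocks. *)
Record is_2design (U : finType) (v k lambda : nat) (B : {set {set U}}) : Prop :=
  Is2Design {
    design_points : #|U| = v;
    design_block : forall b : {set U}, b \in B -> #|b| = k;
    design_pair : forall x y : U, x != y ->
      #|[set b in B | (x \in b) && (y \in b)]| = lambda
  }.

Record is_unital (U : finType) (q : nat) (B : {set {set U}}) : Prop :=
  IsUnital {
    unital_order : 1 < q;
    unital_design : is_2design (q ^ 3 + 1) (q + 1) 1 B
  }.

Definition pencil (U : finType) (B : {set {set U}}) (x : U) : {set {set U}} :=
  [set b in B | x \in b].

(* Adjacency in the confluence graph, whose vertices are the blocks. *)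
Definition confluent (U : finType) : rel {set U} :=
  fun b c => (b != c) && [exists x, (x \in b) && (x \in c)].

Definition confluence_clique (U : finType) (B C : {set {set U}}) : Prop :=
  C \subset B /\ {in C &, forall b c : {set U}, b != c -> confluent b c}.

(* Main.v *)
(** Suppose that no point lies on all blocks of a clique [C] with
    [n >= q^2] blocks, and let [d z] be the number of blocks of [C] through
    [z].  Every [z] is off some block of [C], so [d z <= q + 1], while the
    [d z] add up to [n + q] along each block of [C].  Let [P] be the set of
    points covered by [C].  If [d z = q + 1] for some [z], then [z] is joined
    to all of [P] by blocks of [C], and [|P| = q^2 + q + 1].  Otherwise
    [d z = q] on all of [P], so that [n = q^2] and [|P| = q^2 + q] ([C] is a
    dual affine plane).  Both cases contradict the inequality obtained by
    summing [(m - 1)(m - 2) >= 0] over the blocks outside [C], where [m] is the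
    number of points of [P] on the block. *)

Require Import Defs.
From mathcomp Require Import all_boot.
From mathcomp Require Import zify.

(** * Double counting of incidences in designs and unitals *)

Lemma in_pencil {U : finType} (D : {set {set U}}) (x : U) (b : {set U}) :
  (b \in pencil D x) = (b \in D) && (x \in b).
Proof. by rewrite inE. Qed.

(** The weight [F] is left general: the constant 1 gives the first moment of [#|b :&: S|], and
    [#|b :&: S|] itself the second. *)
Lemma exchange_pencil {U : finType} (D : {set {set U}}) (S : {set U})
    (F : U -> {set U} -> nat) :
  \sum_(x in S) \sum_(b in pencil D x) F x b =
  \sum_(b in D) \sum_(x in b :&: S) F x b.
Proof.
rewrite (exchange_big_dep (mem D)) /=; last first.
  by move=> x b _; rewrite in_pencil => /andP[].
apply: eq_bigr => b bD; apply: eq_bigl => x.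
by rewrite in_pencil bD inE andbC.
Qed.

Lemma sum_card_pencil {U : finType} (D : {set {set U}}) (S : {set U}) :
  \sum_(x in S) #|pencil D x| = \sum_(b in D) #|b :&: S|.
Proof.
under eq_bigr do rewrite -sum1_card.
by rewrite exchange_pencil; under eq_bigr do rewrite sum1_card.
Qed.

Lemma card_pencil_pair {U : finType} {v k l : nat} {B : {set {set U}}}
    {x y : U} :
  is_2design v k l B -> x != y -> #|pencil (pencil B x) y| = l.
Proof.
move=> hD xy; rewrite -(design_pair hD xy); apply: eq_card => b.
by rewrite !inE andbA.
Qed.

Lemma pencilS {U : finType} {C D : {set {set U}}} {x : U} :
  C \subset D -> pencil C x \subset pencil D x.
Proof.
by move=> /subsetP CD; apply/subsetP => b; rewrite !in_pencil => /andP[/CD -> ->].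
Qed.

Lemma card_pencil_design {U : finType} {v k l : nat} {B : {set {set U}}}
    (x : U) :
  is_2design v k l B -> #|pencil B x| * k.-1 = v.-1 * l.
Proof.
move=> hD; have := sum_card_pencil (pencil B x) [set~ x].
rewrite (eq_bigr (fun=> l)); last first.
  by move=> y; rewrite !inE eq_sym => /(card_pencil_pair hD).
rewrite sum_nat_const cardsC1 (design_points hD) => ->.
rewrite -sum_nat_const; apply: eq_bigr => b; rewrite in_pencil => /andP[bB xb].
by have := cardsD1 x b; rewrite xb (design_block hD bB) setDE => ->.
Qed.

Lemma card_pencil_unital {U : finType} {q : nat} {B : {set {set U}}} (x : U) :
  is_unital q B -> #|pencil B x| = q ^ 2.
Proof.
case=> q1 /card_pencil_design -/(_ x); rewrite !addn1 /= muln1.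
by rewrite expnSr => /eqP; rewrite eqn_pmul2r ?(ltnW q1) // => /eqP.
Qed.

Lemma card_unital {U : finType} {q : nat} {B : {set {set U}}} :
  is_unital q B -> #|B| * (q + 1) = (q ^ 3 + 1) * q ^ 2.
Proof.
move=> hB; have hD := unital_design hB.
have := sum_card_pencil B setT.
under eq_bigr do rewrite (card_pencil_unital _ hB).
rewrite sum_nat_const cardsT (design_points hD) => ->.
rewrite -sum_nat_const; apply: eq_bigr => b bB.
by rewrite setIT (design_block hD bB).
Qed.

(* The bound is [(m - 1)(m - 2) >= 0] for the number [m] of points of [P] on a
   block, sharpened to [q (q - 1)] for the blocks of [C], where [m = q + 1]. *)
Lemma unital_subset_ineq {U : finType} {q : nat} {B C : {set {set U}}}
    {P : {set U}} :
  is_unital q B -> C \subset B -> (forall b, b \in C -> b \subset P) ->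
  3 * (#|P| * q ^ 2) + #|C| * (q * q.-1) <=
  #|P| * (q ^ 2 + #|P|.-1) + 2 * #|B|.
Proof.
move=> hB CB CP; have hD := unital_design hB.
have m1 : \sum_(b in B) #|b :&: P| = #|P| * q ^ 2.
  rewrite -sum_card_pencil.
  under eq_bigr do rewrite (card_pencil_unital _ hB).
  by rewrite sum_nat_const.
(* The squares count triples [(x, y, b)] with [x] and [y] in [b :&: P]: for each [x] there are
   [q ^ 2] blocks with [y = x], and one block for every other [y] of [P]. *)
have m2 : \sum_(b in B) #|b :&: P| ^ 2 = #|P| * (q ^ 2 + #|P|.-1).
  under eq_bigr do rewrite -mulnn -sum_nat_const.
  rewrite -(exchange_pencil B P (fun _ b => #|b :&: P|)).
  rewrite -sum_nat_const; apply: eq_bigr => x xP.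
  rewrite -sum_card_pencil (bigD1 x) //=; congr (_ + _).
    rewrite -(card_pencil_unital x hB); apply: eq_card => b.
    by rewrite !in_pencil -andbA andbb.
  rewrite (eq_bigr (fun=> 1)); last first.
    by move=> y /andP[_]; rewrite eq_sym => /(card_pencil_pair hD).
  rewrite sum1_card (cardsD1 x P) xP /=; apply: eq_card => y.
  by rewrite !inE andbC.
have mC : \sum_(b in B) (b \in C) * (q * q.-1) = #|C| * (q * q.-1).
  rewrite -big_distrl /= -sum1_card; congr (_ * _).
  rewrite [RHS]big_mkcond [LHS]big_mkcond /=; apply: eq_bigr => b _.
  by case: ifP => [|/negbT nB]; [case: (b \in C) | rewrite (contraNF (subsetP CB b))].
rewrite -m1 -m2 -mC -sum1_card !big_distrr -!big_split /=.
(* With [m = #|b :&: P|], the claim for one block is [3m + [b in C] q(q - 1) <= m^2 + 2], an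
   equality at [m = q + 1]. *)
apply: leq_sum => b bB; have := unital_order hB.
case: (boolP (b \in C)) => [bC|_] q1.
  by rewrite (setIidPl (CP b bC)) (design_block hD bB); case: q q1 {hB hD m1 m2 mC bB} => [|r] // _; nia.
by case: #|_| => [|[|m]]; nia.
Qed.

(** * Numbers of clique blocks through a point *)

Lemma card_cliqueI {U : finType} {v k : nat} {B C : {set {set U}}}
    {b c : {set U}} :
  is_2design v k 1 B -> confluence_clique B C ->
  b \in C -> c \in C -> b != c -> #|b :&: c| = 1.
Proof.
move=> hD [CB hC] bC cC bc; apply/eqP; rewrite eqn_leq; apply/andP; split.
  apply/card_le1_eqP => x y; rewrite !inE => /andP[xb xc] /andP[yb yc].
  apply: contraNeq bc => xy; apply/eqP.
  have /eq_leq/card_le1_eqP := card_pencil_pair hD xy.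
  by apply; rewrite !in_pencil ?(subsetP CB) ?xb ?yb ?xc ?yc.
have /andP[_ /existsP[x xbc]] := hC b c bC cC bc.
by apply/card_gt0P; exists x; rewrite inE.
Qed.

Lemma sum_pencil_clique_block {U : finType} {v k : nat} {B C : {set {set U}}}
    {b : {set U}} :
  is_2design v k 1 B -> confluence_clique B C -> b \in C ->
  \sum_(z in b) #|pencil C z| = k + #|C|.-1.
Proof.
move=> hD hC bC; rewrite sum_card_pencil (bigD1 b) //= setIid.
rewrite (design_block hD (subsetP hC.1 b bC)); congr (_ + _).
rewrite (eq_bigr (fun=> 1)) => [|c /andP[cC cb]]; last first.
  exact: card_cliqueI hD hC cC bC cb.
by rewrite sum1_card (cardsD1 b C) bC /=; apply: eq_card => c; rewrite !inE andbC.
Qed.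

(** Each block of [C] through [z] differs from [b], so it meets [b] in exactly one point. *)
Lemma sum_pencil_pencil_clique {U : finType} {v k : nat}
    {B C : {set {set U}}} {b : {set U}} {z : U} :
  is_2design v k 1 B -> confluence_clique B C -> b \in C -> z \notin b ->
  \sum_(y in b) #|pencil (pencil C z) y| = #|pencil C z|.
Proof.
move=> hD hC bC zb; rewrite sum_card_pencil -sum1_card; apply: eq_bigr => c.
rewrite in_pencil => /andP[cC zc]; apply: (card_cliqueI hD hC) => //.
by apply: contraNneq zb => <-.
Qed.

Lemma card_pencil_pair_le1 {U : finType} {v k : nat} {B C : {set {set U}}}
    {x y : U} :
  is_2design v k 1 B -> C \subset B -> x != y ->
  #|pencil (pencil C x) y| <= 1.
Proof.
move=> hD CB xy; rewrite -(card_pencil_pair hD xy).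
by apply: subset_leq_card; do 2!apply: pencilS.
Qed.

Lemma card_pencil_clique_le {U : finType} {v k : nat} {B C : {set {set U}}}
    {b : {set U}} {z : U} :
  is_2design v k 1 B -> confluence_clique B C -> b \in C -> z \notin b ->
  #|pencil C z| <= k.
Proof.
move=> hD hC bC zb; rewrite -(sum_pencil_pencil_clique hD hC bC zb).
rewrite -(design_block hD (subsetP hC.1 b bC)) -sum1_card.
apply: leq_sum => y yb; apply: card_pencil_pair_le1 hD hC.1 _.
by apply: contraNneq zb => ->.
Qed.

(* A block [c] of [C] off [z] meets the [k] blocks of [C] through [z] in
   distinct points, so these blocks cover [c]. *)
Lemma full_point_joined {U : finType} {v k : nat} {B C : {set {set U}}}
    {y z : U} :
  is_2design v k 1 B -> confluence_clique B C -> #|pencil C z| = k ->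
  y \in cover C -> z != y -> #|pencil (pencil C z) y| = 1.
Proof.
move=> hD hC dz /bigcupP[c cC yc] zy; apply/eqP; rewrite eqn_leq.
rewrite (card_pencil_pair_le1 hD hC.1 zy) /=.
have [zc|zc] := boolP (z \in c).
  by apply/card_gt0P; exists c; rewrite !in_pencil cC zc yc.
have := sum_pencil_pencil_clique hD hC cC zc.
rewrite dz -(design_block hD (subsetP hC.1 c cC)) -sum1_card.
rewrite (bigD1 y) //= [RHS](bigD1 y) //=.
(* If [y] were not joined to [z], the other [k - 1] points of [c], contributing at most 1 each,
   would have to add up to [k]. *)
have : \sum_(i in c | i != y) #|pencil (pencil C z) i| <=
       \sum_(i in c | i != y) 1.
  apply: leq_sum => i /andP[ic _]; apply: card_pencil_pair_le1 hD hC.1 _.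
  by apply: contraNneq zc => ->.
by case: posnP => // -> /[swap]; rewrite add0n add1n => ->; rewrite ltnn.
Qed.

(** The [k] blocks of [C] through [z] partition the other covered points into sets of size
    [k - 1]. *)
Lemma card_cover_full_point {U : finType} {v k : nat} {B C : {set {set U}}}
    {z : U} :
  is_2design v k 1 B -> confluence_clique B C -> 0 < k ->
  #|pencil C z| = k -> #|cover C| = k * k.-1 + 1.
Proof.
move=> hD hC k0 dz.
have zP : z \in cover C.
  have /card_gt0P[b] : 0 < #|pencil C z| by rewrite dz.
  by rewrite in_pencil => /andP[bC zb]; apply/bigcupP; exists b.
rewrite (cardsD1 z) zP addnC; congr (_ + _).
have := sum_card_pencil (pencil C z) (cover C :\ z).
rewrite (eq_bigr (fun=> 1)) => [|y]; last first.
  by rewrite !inE eq_sym => /andP[zy yP]; apply: full_point_joined hD hC dz yP zy.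
rewrite sum1_card => ->.
rewrite -{1}dz -sum_nat_const; apply: eq_bigr => b.
rewrite in_pencil => /andP[bC zb].
have bP : b \subset cover C by apply: bigcup_sup bC.
have := cardsD1 z b; rewrite zb (design_block hD (subsetP hC.1 b bC)) => ->.
by rewrite setIDA (setIidPl bP).
Qed.

Lemma card_cover_no_full_point {U : finType} {q : nat} {B C : {set {set U}}} :
  is_unital q B -> confluence_clique B C -> q ^ 2 <= #|C| ->
  (forall z, #|pencil C z| <= q) -> #|cover C| = q * (q + 1).
Proof.
move=> hB hC nC dle; have hD := unital_design hB; have q1 := unital_order hB.
have CP b : b \in C -> b \subset cover C by move=> bC; apply: bigcup_sup bC.
(* Along [b], [q + 1] numbers that are at most [q] add up to [#|C| + q >= (q + 1) * q], so equality
   holds throughout. *)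
have dP z b : b \in C -> z \in b -> #|C| = q ^ 2 /\ #|pencil C z| = q.
  move=> bC zb; have bk := design_block hD (subsetP hC.1 b bC).
  have := sum_pencil_clique_block hD hC bC; rewrite (bigD1 z) //=.
  have : \sum_(i in b | i != z) #|pencil C i| <= \sum_(i in b | i != z) q.
    by apply: leq_sum => i _; apply: dle.
  have : \sum_(i in b) q = (q + 1) * q by rewrite sum_nat_const bk.
  rewrite (bigD1 z) //=; move: (dle z) nC.
  move: #|C| #|pencil C z| (\sum_(_ in b | _) #|_|) (\sum_(_ in b | _) q) => n d s t.
  have : 0 < q * q by rewrite muln_gt0 !(ltnW q1).
  rewrite -mulnn mulnDl mul1n; lia.
have [b bC] : exists b, b \in C by apply/card_gt0P; nia.
have [z zb] : exists z, z \in b.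
  by apply/card_gt0P; rewrite (design_block hD (subsetP hC.1 b bC)) addn1.
have nE := (dP z b bC zb).1.
have := sum_card_pencil C (cover C).
rewrite (eq_bigr (fun=> q)) => [|y /bigcupP[c cC yc]]; last first.
  exact: (dP y c cC yc).2.
rewrite sum_nat_const [RHS](eq_bigr (fun=> q + 1)) => [|c cC]; last first.
  by rewrite (setIidPl (CP c cC)) (design_block hD (subsetP hC.1 c cC)).
rewrite sum_nat_const nE => /eqP.
by rewrite -mulnn mulnAC eqn_pmul2r ?(ltnW q1) // => /eqP.
Qed.

(** * Cliques without a common point, and the conclusion *)

Lemma card_nonconcurrent_clique {U : finType} {q : nat}
    {B C : {set {set U}}} :
  is_unital q B -> 2 < q -> confluence_clique B C ->
  (forall z, exists2 b, b \in C & z \notin b) -> #|C| < q ^ 2.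
Proof.
move=> hB q2 hC off; rewrite ltnNge; apply/negP => nC.
have hD := unital_design hB.
have dle z : #|pencil C z| <= q + 1.
  by have [b bC zb] := off z; apply: card_pencil_clique_le hD hC bC zb.
have ineq : 3 * (#|cover C| * q ^ 2) + q ^ 2 * (q * q.-1) <=
    #|cover C| * (q ^ 2 + #|cover C|.-1) + 2 * #|B|.
  apply: leq_trans (unital_subset_ineq hB hC.1 _).
    by rewrite leq_add2l leq_mul2r nC orbT.
  by move=> b bC; apply: bigcup_sup bC.
(* This is [#|B| = q^2 (q^2 - q + 1)], stated without truncated subtraction. *)
have BE : #|B| + q ^ 3 = q ^ 4 + q ^ 2.
  have := card_unital hB; rewrite !expnS expn0; nia.
have [/existsP[z /eqP dz]|no] := boolP [exists z, #|pencil C z| == q + 1].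
  have pE : #|cover C| = q * q + q + 1.
    by rewrite (card_cover_full_point hD hC _ dz) addn1 //=; lia.
  (* The left side of [ineq] exceeds the right by [q^3 - 2q^2 - q], which is positive from [q = 3]
     on but negative at [q = 2]. *)
  move: ineq BE; rewrite pE; case: q q2 {hB hC hD nC dle dz pE} => [|[|[|r]]] // _.
  rewrite !expnS expn0; nia.
have pE := card_cover_no_full_point hB hC nC.
move: ineq BE; rewrite pE => [|z]; last first.
  by move: no; rewrite negb_exists => /forallP/(_ z); have := dle z; lia.
(* Here the excess is [q (q - 1)^2]. *)
case: q q2 {hB hC hD nC dle no pE} => [|[|[|r]]] // _.
rewrite !expnS expn0; nia.
Qed.

Theorem theorem2p1 (U : finType) (q : nat) (B : {set {set U}})
    (hB : is_unital q B) (hq : 2 < q)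
    (C : {set {set U}}) (hC : confluence_clique B C) :
  #|C| <= q ^ 2 /\ (#|C| = q ^ 2 <-> exists x : U, C = pencil B x).
Proof.
have [/existsP[x Cx]|no] := boolP [exists x, C \subset pencil B x].
  have dx := card_pencil_unital x hB; split.
    by rewrite -dx; apply: subset_leq_card.
  split=> [nC|[y ->]]; last exact: card_pencil_unital.
  by exists x; apply/eqP; rewrite eqEcard Cx dx nC /=.
(* Without a common point the bound is strict, so both sides of the equivalence are false. *)
have lt : #|C| < q ^ 2.
  apply: (card_nonconcurrent_clique hB hq hC) => z.
  move: no; rewrite negb_exists => /forallP/(_ z)/subsetPn[b bC].
  by rewrite in_pencil (subsetP hC.1 b bC) => zb; exists b.
split; first exact: ltnW.
split=> [nC|[x CE]]; first by rewrite nC ltnn in lt.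
by rewrite CE (card_pencil_unital x hB) ltnn in lt.
Qed.
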